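(* Let $m,n\geq 2$ be integers and assume that $G_{m,n}$ is irreducible over $\mathbb{Q}$. Let $c_0$ be a root of $G_{m,n}$ and let $K=\mathbb{Q}(c_0)$. Then: (1) $G_{m,1}(c_0)$ is not a unit in $\mathcal{O}_K$; (2) if $n$ is even, then $G_{m,2}(c_0)$ is not a unit in $\mathcal{O}_K$.
   Context: Let $f_c(z)=z^2+c$. Define polynomials $a_i\in\mathbb{Z}[c]$ by $a_1=c$ and $a_{i+1}=a_i^2+c$ (so $a_i=f_c^i(0)$). For integers $m\geq 2$, $n\geq 1$, the Misiurewicz polynomial is $G_{m,n}(c)=\prod_{k\mid n}\big(a_{m+k-1}+a_{m-1}\big)^{\mu(n/k)}\cdot \epsilon$, where $\epsilon=\prod_{k\mid n}a_k^{-\mu(n/k)}$ if $n\mid m-1$ and $\epsilon=1$ otherwise; $\mu$ is the Möbius function. (This is a monic polynomial in $\mathbb{Z}[c]$.) *)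

(* Defs.v *)
From HB Require Import structures.
From mathcomp Require Import all_boot all_order all_algebra all_field.
Set Implicit Arguments.
Unset Strict Implicit.
Unset Printing Implicit Defensive.
Import GRing.Theory.
Local Open Scope ring_scope.
Local Notation "x %:F" := (tofrac x).

(* The variable 'X plays the role of the parameter c. *)
Definition crit_orbit (i : nat) : {poly rat} :=
  iter i (fun z => z ^+ 2 + 'X) 0.

Lemma crit_orbit1 : crit_orbit 1 = 'X.
Proof. by rewrite /crit_orbit /= expr0n add0r. Qed.

Lemma crit_orbitS i : crit_orbit i.+1 = crit_orbit i ^+ 2 + 'X.
Proof. by []. Qed.

Definition moebius (n : nat) : int :=
  if all (fun p => logn p n == 1%N) (primes n)
  then (-1) ^+ size (primes n) else 0.

(* The exponents are integers, possibly negative, so the product is formed in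
   the field Q(c) of rational functions. *)
Definition misiurewicz_frac (m n : nat) : {fraction {poly rat}} :=
  (\prod_(k <- divisors n)
     (crit_orbit (m + k - 1)%N + crit_orbit (m - 1)%N)%:F ^ moebius (n %/ k)%N) *
  (if (n %| m - 1)%N
   then \prod_(k <- divisors n) (crit_orbit k)%:F ^ (- moebius (n %/ k)%N)
   else 1).

(* The polynomial equal to a rational function x, when there is one
   (see frac_polyK); the value is irrelevant otherwise. *)
Definition frac_poly (x : {fraction {poly rat}}) : {poly rat} :=
  \n_(repr x) %/ \d_(repr x).

Lemma frac_polyK (p : {poly rat}) : frac_poly p%:F = p.
Proof.
rewrite /frac_poly -[X in _ = X](mulpK p (denom_ratioP (repr p%:F))).
congr (_ %/ _); unlock tofrac; have := FracField.equivf_l (Ratio p 1).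
by rewrite !numden_Ratio ?oner_eq0 //= mulr1 [RHS]mulrC.
Qed.

Definition misiurewicz (m n : nat) : {poly rat} :=
  frac_poly (misiurewicz_frac m n).

(* O_K, for a subfield K of the number field L. *)
Definition ring_of_integers (L : fieldExtType rat) (K : {vspace L}) (x : L) :
    Prop :=
  x \in K /\ integralOver (intr : int -> L) x.

Definition is_nonunit (L : fieldExtType rat) (A : L -> Prop) (x : L) : Prop :=
  A x /\ ~ (exists2 y, A y & x * y = 1).

(* Main.v *)
Require Import Defs.
From HB Require Import structures.
From mathcomp Require Import all_boot all_order all_algebra all_field.
From mathcomp Require Import ring zify.
Set Implicit Arguments.
Unset Strict Implicit.
Unset Printing Implicit Defensive.
Import Order.TTheory GRing.Theory Num.Theory.
Local Open Scope ring_scope.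

(** Write u_k = a_(m+k-1) + a_(m-1). The roots of u_k are simple, because
    u_k' is twice a number which is odd at each of them, and the set of k with
    u_k(c) = 0 consists of the multiples of one integer, the level of c. Hence
    u_n is the product over d | n of W_d, the product of the X - c with c of
    level d; by Moebius inversion G_(m,n) is W_n, divided, when n | m-1, by the
    analogous factor V_n of a_n.

    If G_(m,1)(c0) is a unit, its inverse lies in Z[c0], so G_(m,1) and G_(m,n)
    generate the unit ideal of Z[X] and G_(m,n)(c) is an algebraic unit at each
    root c of G_(m,1). There a_m is a fixed point x with x^2 - x + c = 0,
    V_n(c) is a unit, and W_n(c) = Phi_n(2x), where 2x is the multiplier.
    Therefore zeta - 2x is a unit for every primitive n-th root of unity zeta.
    Multiplying over all x, and writing y = 1/zeta, one finds an H in Z[Y],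
    congruent to 1 - 2^e Y modulo 2^(e+1) with e >= 2 (or to -1 + 4Y), such that
    H(y) is a unit. But H(y) - H(1/y) is 2^e times a nonzero algebraic integer,
    whereas each of its conjugates is at most twice the one of H(y) in absolute
    value, so that its norm is at most 2^phi(n): a contradiction.

    For G_(m,2) the fixed point is replaced by a cycle of length 2 with
    multiplier 4(c + 1), and n by n/2. *)

(** * Evaluation of integer polynomials and algebraic integers *)

(** The target ring is arbitrary, so that one identity in Z[X] can be read both in [algC] and in the
    number field. *)
Definition zeval (R : comNzRingType) (x : R) (p : {poly int}) : R :=
  (map_poly intr p).[x].

HB.instance Definition _ (R : comNzRingType) (x : R) :=
  GRing.RMorphism.copy (zeval x) (horner_eval x \o map_poly intr).

Lemma zevalX (R : comNzRingType) (x : R) : zeval x 'X = x.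
Proof. by rewrite /zeval map_polyX hornerX. Qed.

Lemma zevalC (R : comNzRingType) (x : R) a : zeval x a%:P = a%:~R.
Proof. by rewrite /zeval map_polyC hornerC. Qed.

Lemma zevalD (R : comNzRingType) (x : R) : {morph zeval x : p q / p + q}.
Proof. exact: rmorphD. Qed.

Lemma zevalN (R : comNzRingType) (x : R) : {morph zeval x : p / - p}.
Proof. exact: rmorphN. Qed.

Lemma zevalM (R : comNzRingType) (x : R) : {morph zeval x : p q / p * q}.
Proof. exact: rmorphM. Qed.

Lemma zeval_exp (R : comNzRingType) (x : R) n :
  {morph zeval x : p / p ^+ n}.
Proof. exact: rmorphXn. Qed.

Lemma zeval0 (R : comNzRingType) (x : R) : zeval x 0 = 0.
Proof. exact: rmorph0. Qed.

Lemma zeval1 (R : comNzRingType) (x : R) : zeval x 1 = 1.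
Proof. exact: rmorph1. Qed.

Lemma zevalMn (R : comNzRingType) (x : R) n :
  {morph zeval x : p / p *+ n}.
Proof. exact: rmorphMn. Qed.

Definition zevalE := (zevalX, zevalC, zeval0, zeval1, zevalMn, zevalN, zeval_exp,
  zevalM, zevalD).

Lemma zeval_comp (R : comNzRingType) (x : R) p q :
  zeval x (p \Po q) = zeval (zeval x q) p.
Proof. by rewrite /zeval map_comp_poly horner_comp. Qed.

Lemma zeval_Aint p (x : algC) : x \in Aint -> zeval x p \in Aint.
Proof.
move=> xA; rewrite /zeval horner_coef rpred_sum // => i _.
by rewrite rpredM ?rpredX // coef_map /= Aint_int.
Qed.

Lemma monic_int_root_Aint (p : {poly int}) (x : algC) :
  p \is monic -> zeval x p = 0 -> x \in Aint.
Proof.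
move=> mp px; apply: (@root_monic_Aint (map_poly intr p)).
- exact/eqP.
- exact: monic_map.
by apply/polyOverP=> i; rewrite coef_map /= intr_int.
Qed.

(** A rational algebraic integer is an integer, and 1/2 is not one. All parity arguments end here:
    an odd algebraic integer is not zero. *)
Lemma Aint_half_absurd (x : algC) : x \in Aint -> 1 <> 2%:R * x.
Proof.
move=> xA e; have xe : x = 2%:R^-1.
  by apply: (@mulfI _ 2%:R); rewrite ?pnatr_eq0 // -e divff ?pnatr_eq0.
have xi : x \in Num.int.
  by apply: Cint_rat_Aint => //; rewrite xe rpredV rpred_nat.
have /intrP[k kE] := xi.
have : (2 * k)%:~R = 1 :> algC by rewrite intrM -kE -e.
by rewrite -[1]/(1%:~R) => /intr_inj; lia.
Qed.

Lemma Aint_dvd1_int (a : int) (z : algC) :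
  z \in Aint -> a%:~R * z = 1 -> `|a| = 1.
Proof.
move=> zA e; have a0 : a != 0.
  by apply/eqP=> a0; move: e; rewrite a0 mul0r => /esym/eqP; rewrite oner_eq0.
have ze : z = a%:~R^-1.
  by apply: (@mulfI _ a%:~R); rewrite ?intr_eq0 // e divff ?intr_eq0.
have /intrP[k kE] : z \in Num.int.
  by apply: Cint_rat_Aint => //; rewrite ze rpredV rpred_int.
have : (a * k)%:~R = 1 :> algC by rewrite intrM -kE.
rewrite -[1]/(1%:~R) => /intr_inj /(congr1 absz); rewrite abszM => /eqP.
by rewrite muln_eq1 => /andP[/eqP ha _]; lia.
Qed.

(** Division by a monic polynomial can be done over Z. Comparing degrees over F identifies q with
    the integer quotient, and the remainder then vanishes. *)
Lemma monic_int_quotient (F : fieldType) (iota : {rmorphism int -> F})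
    (p d : {poly int}) (q : {poly F}) :
    injective iota -> d \is monic ->
    map_poly iota p = q * map_poly iota d ->
  exists2 r : {poly int}, p = r * d & q = map_poly iota r.
Proof.
move=> inj md e; pose r := Pdiv.CommonRing.rdivp p d.
have mdF : map_poly iota d \is monic by apply: monic_map.
have De := Pdiv.RingMonic.rdivp_eq md p; rewrite -/r in De.
set s := Pdiv.CommonRing.rmodp p d in De.
have ss : (size s < size d)%N by rewrite Pdiv.CommonRing.ltn_rmodp monic_neq0.
have qr : q = map_poly iota r.
  apply/eqP; rewrite -subr_eq0; apply/negP=> /negP nz.
  have : (q - map_poly iota r) * map_poly iota d = map_poly iota s.
    by rewrite mulrBl -e {1}De rmorphD rmorphM /= addrAC subrr add0r.
  move/(congr1 (fun t : {poly F} => size t)).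
  rewrite size_Mmonic // !size_map_inj_poly ?rmorph0 //.
  move: nz ss; rewrite -size_poly_gt0; case: (size _) => // k _ ss.
  by rewrite addSn /= => E; move: ss; rewrite -E ltnNge leq_addl.
exists r => //; apply: (map_inj_poly inj); first exact: rmorph0.
by rewrite e qr rmorphM.
Qed.

Lemma monic_map_intr (p : {poly int}) :
  (map_poly (intr : int -> algC) p \is monic) = (p \is monic).
Proof.
rewrite !monicE lead_coef_map_inj //; last exact: intr_inj.
by rewrite -[1]/(1%:~R) (inj_eq (@intr_inj algC)).
Qed.

(* The product is the determinant of R evaluated at the companion matrix of p. *)
Lemma prod_roots_int (p R : {poly int}) (rs : seq algC) :
    map_poly intr p = \prod_(r <- rs) ('X - r%:P) ->
  \prod_(r <- rs) zeval r R \in Num.int.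
Proof.
move=> Dp; have mp : p \is monic.
  by rewrite -monic_map_intr Dp monic_prod_XsubC.
have [A DA] : exists A : 'M[int]_((size p).-1), char_poly A = p.
  by exists (companionmx p); rewrite companionmxK.
have sz : (size p).-1 = size rs.
  by rewrite -(size_map_inj_poly (@intr_inj algC)) // Dp size_prod_XsubC.
(* Polynomials in a matrix require positive dimension, so degree 0, where the product is empty, is
   separated. *)
case Ed: (size p).-1 A DA sz => [|d] A DA sz.
  by rewrite (size0nil (esym sz)) big_nil rpred1.
pose B : 'M[algC]_d.+1 := map_mx intr A.
have cB : char_poly B = \prod_(r <- rs) ('X - r%:P).
  by rewrite -map_char_poly DA.
(* With R split into factors X - t, the determinant of R(B) is a product of det(B - t), each of
   which is a product over the roots of p. *)
have [ts Dt] := closed_field_poly_normal (map_poly (intr : int -> algC) R).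
set a := lead_coef _ in Dt.
have constX (t : algC) : t ^+ size rs = \prod_(r <- rs) t.
  by elim: (rs) => [|r s IH]; rewrite ?big_nil ?expr0 // big_cons exprS IH.
have detB t : \det (B - t%:M) = \prod_(r <- rs) (r - t).
  have := congr1 (fun q => q.[t]) cB; rewrite horner_prod /char_poly.
  rewrite -horner_evalE -det_map_mx => E.
  have -> : B - t%:M = - map_mx (horner_eval t) (char_poly_mx B).
    apply/matrixP=> i j; rewrite !mxE /= !horner_evalE !hornerE.
    by rewrite hornerMn hornerX opprB.
  rewrite -scaleN1r detZ E sz constX -big_split /=.
  by apply: eq_bigr => r _; rewrite !hornerE mulN1r opprB.
suff -> : \prod_(r <- rs) zeval r R = (\det (horner_mx A R))%:~R.
  exact: intr_int.
rewrite -det_map_mx map_horner_mx -/B Dt.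
rewrite horner_mxZ rmorph_prod /= detZ.
rewrite (big_morph _ (@det_mulmx _ _) (det1 _ _)).
under [X in _ = _ * X]eq_bigr do
  rewrite rmorphB /= horner_mx_X horner_mx_C detB.
rewrite exchange_big /= sz constX -big_split /=.
by apply: eq_bigr => r _; rewrite /zeval Dt hornerZ horner_prod; congr (_ * _);
  apply: eq_bigr => t _; rewrite !hornerE.
Qed.

(** * Algebraic units in cyclotomic fields *)

(** X is congruent to q modulo X - q, hence so are p(X) and p(q). *)
Lemma sub_comp_poly (R : comNzRingType) (p q : {poly R}) :
  exists s, p - (p \Po q) = ('X - q) * s.
Proof.
elim/poly_ind: p => [|p a [s Ds]]; first by exists 0; rewrite comp_poly0 subr0 mulr0.
exists (s * 'X + (p \Po q)); rewrite comp_poly_MXaddC.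
have -> : p * 'X + a%:P - ((p \Po q) * q + a%:P)
  = (p - (p \Po q)) * 'X + ('X - q) * (p \Po q) by ring.
rewrite Ds; ring.
Qed.

Definition Aunit (x : algC) : Prop := exists2 z, z \in Aint & x * z = 1.

Lemma Aunit_prod (I : eqType) (r : seq I) (F : I -> algC) :
  {in r, forall i, Aunit (F i)} -> Aunit (\prod_(i <- r) F i).
Proof.
elim: r => [|i r IH] h; first by exists 1; rewrite ?big_nil ?mulr1.
have [z zA ze] := h i (mem_head _ _).
have [|w wA we] := IH; first by move=> j jr; apply: h; rewrite inE jr orbT.
exists (z * w); first exact: rpredM.
by rewrite big_cons mulrACA ze we mulr1.
Qed.

Lemma Aunit_mull (x y : algC) : x \in Aint -> Aunit (x * y) -> Aunit y.
Proof. by move=> xA [z zA e]; exists (x * z); [exact: rpredM | rewrite -e; ring]. Qed.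

Lemma AunitM (x y : algC) : Aunit x -> Aunit y -> Aunit (x * y).
Proof.
move=> [z zA ze] [w wA we]; exists (z * w); first exact: rpredM.
by rewrite mulrACA ze we mulr1.
Qed.

Lemma Aunit_unity_root n (x : algC) : (0 < n)%N -> x ^+ n = 1 -> Aunit x.
Proof.
case: n => // n _ xn; exists (x ^+ n); last by rewrite -exprS.
by rewrite rpredX // (@Aint_unity_root n.+1) //; apply/unity_rootP.
Qed.

Lemma AunitN (x : algC) : Aunit x -> Aunit (- x).
Proof. by move=> [z zA e]; exists (- z); rewrite ?rpredN // mulrNN. Qed.

(** The number differs from d by 4P times the odd integer 2t - d', hence by at least 4, while two
    signs differ by at most 2. With P = 2^(e-2) this is the value at y = -1 in the next lemma. *)
Lemma int_norm_congruence (d d' P t : int) :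
    `|d| = 1 -> `|d'| = 1 -> 0 < P ->
  `|d + 2 * (2 * P) * d' * (-1) + 2 * (2 * (2 * P)) * t| <> 1.
Proof.
move=> d1 d'1 P0 h.
have [|] : 4 * P * (2 * t - d') = 0 \/ `|4 * P * (2 * t - d')| = 2 by lia.
  by move/eqP; rewrite mulf_eq0 => /orP[/eqP|/eqP]; lia.
have -> : 4 * P * (2 * t - d') = 4 * (P * (2 * t - d')) by ring.
by rewrite normrM; lia.
Qed.

(* If H(y) were a unit, then H(y) - H(1/y), which is divisible by 2^e, would be
   too small: its conjugates are bounded by those of 2 H(y). *)
Lemma not_Aunit_congruence (n e : nat) (d d' : int) (T : {poly int}) :
    (2 <= n)%N -> (2 <= e)%N -> `|d| = 1 -> `|d'| = 1 ->
  ~ (forall y : algC, n.-primitive_root y ->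
       Aunit (zeval y (d%:P + 2 ^+ e * d'%:P * 'X + 2 ^+ e.+1 * T))).
Proof.
move=> n2 e2 d1 d'1; pose H := d%:P + 2 ^+ e * d'%:P * 'X + 2 ^+ e.+1 * T.
rewrite -/H => Hu.
have zevalH y : zeval y H
    = d%:~R + 2 ^+ e * d'%:~R * y + 2 ^+ e.+1 * zeval y T :> algC.
  by rewrite /H !zevalE.
have [z0 pz0] := @C_prim_root_exists n (ltnW n2).
(* For n = 2 the root -1 is its own inverse and H(y) - H(1/y) vanishes, so the integer H(-1) is
   examined directly. *)
have [n_eq2|n3] := eqVneq n 2%N.
  have y1 : n.-primitive_root (-1 : algC).
    rewrite n_eq2; have e1 : (-1 : algC) ^+ 2 = 1 by rewrite sqrrN expr1n.
    have [k pk kd] := prim_order_exists (ltn0Sn 1) e1.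
    have : (k == 1)%N || (k == 2)%N.
      by have := dvdn_leq (ltn0Sn 1) kd; have := prim_order_gt0 pk; lia.
    case/orP=> /eqP kE; last by rewrite -kE.
    move: (prim_expr_order pk); rewrite kE expr1 => /eqP.
    by rewrite -subr_eq0 -opprD oppr_eq0 (@pnatr_eq0 _ 2).
  have [z zA] := Hu _ y1.
  have -> : zeval (-1 : algC) H
      = (d + 2 ^+ e * d' * (-1) + 2 ^+ e.+1 * T.[-1])%:~R.
    rewrite zevalH !rmorphD !rmorphM /= !rmorphXn /= !rmorphN1; congr (_ + _ * _).
    by rewrite /zeval -(rmorphN1 (intr : int -> algC)) horner_map.
  move=> /(Aint_dvd1_int zA); move: e2 d1 d'1.
  case: e {H Hu zevalH} => [|[|e]] // _ d1 d'1; rewrite !exprS.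
  by apply: int_norm_congruence; rewrite ?exprn_gt0.
have n_gt2 : (2 < n)%N by rewrite ltn_neqAle eq_sym n3.
pose rs := [seq z0 ^+ val k | k <- enum [pred k : 'I_n | coprime k n]].
have Dp : map_poly (intr : int -> algC) 'Phi_n = \prod_(r <- rs) ('X - r%:P).
  by rewrite (Cintr_Cyclotomic pz0) big_map big_enum.
have prs r : r \in rs -> n.-primitive_root r.
  case/mapP=> k; rewrite mem_enum inE => ck ->.
  by rewrite prim_root_exp_coprime.
have rs0 : (0 < size rs)%N.
  rewrite -ltnS -(size_prod_XsubC rs id) -Dp size_map_inj_poly //; last exact: intr_inj.
  by rewrite size_Cyclotomic ltnS totient_gt0 ltnW.
(* At an n-th root of unity X^(n-1) takes the value 1/y, so H(y) - H(1/y) becomes 2^e R(y) with R in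
   Z[X]. *)
have [S DS] := sub_comp_poly T 'X^(n.-1).
pose R := ('X - 'X^(n.-1)) * (d'%:P + 2%:P * S).
have HR r : r \in rs -> zeval r H - zeval (r ^+ n.-1) H = 2 ^+ e * zeval r R.
  move=> rin; rewrite !zevalH /R !zevalE exprS; have := congr1 (zeval r) DS.
  rewrite !zevalE zeval_comp !zevalE => E.
  transitivity (2 ^+ e * (d'%:~R * (r - r ^+ n.-1) + 2 * (zeval r T - zeval (r ^+ n.-1) T))).
    by ring.
  by rewrite E; ring.
have rconj r : r \in rs -> r ^+ n.-1 = r^* .
  move=> /prs pr; have r1 : `|r| = 1.
    apply/eqP; rewrite -(@pexpr_eq1 _ _ n) ?normr_ge0 ?(ltnW n2) //.
    by rewrite -normrX (prim_expr_order pr) normr1.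
  have r0 : r != 0 by rewrite -normr_gt0 r1.
  apply: (mulfI r0); rewrite -exprS (ltn_predK n2) (prim_expr_order pr).
  by rewrite -normCK r1 expr1n.
have Hconj r : r \in rs -> `|zeval (r ^+ n.-1) H| = `|zeval r H|.
  move=> rin; rewrite (rconj _ rin) -[RHS]norm_conjC; congr (`|_|).
  rewrite !zevalH !rmorphD !rmorphM /= !rmorphXn /= !rmorph_int ?rmorph_nat.
  congr (_ + _ * _); rewrite /zeval -horner_map; congr (_.[_]).
  by rewrite -map_poly_comp; apply: eq_map_poly => a; rewrite /= rmorph_int.
(* The first factor of R is nonzero because n > 2 excludes r = 1/r; the second, d' + 2 S(r), is
   odd. *)
have R0 r : r \in rs -> zeval r R != 0.
  move=> rin; have pr := prs _ rin.
  rewrite /R !zevalE mulf_neq0 //.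
    apply/eqP=> /eqP; rewrite subr_eq0 => /eqP rr.
    have : (n %| 2)%N.
      by rewrite (prim_order_dvd pr) expr2 {2}rr -exprS (ltn_predK n2) (prim_expr_order pr).
    by move/dvdn_leq => /(_ isT); rewrite leqNgt n_gt2.
  apply/eqP=> E; have rA : r \in Aint by exact: Aint_prim_root pr.
  have SA := zeval_Aint S rA.
  have : 1 = 2 * (- d'%:~R * zeval r S) :> algC.
    have dd : d'%:~R * d'%:~R = 1 :> algC.
      rewrite -intrM; have -> : d' * d' = 1 by lia.
      by [].
    have Ed : d'%:~R = - (2 * zeval r S) by apply/eqP; rewrite -addr_eq0; apply/eqP.
    by rewrite -[LHS]dd {2}Ed; ring.
  by apply: Aint_half_absurd; rewrite rpredM ?rpredN ?Aint_int.
have RI : 1 <= `|\prod_(r <- rs) zeval r R|.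
  apply: norm_intr_ge1; first exact: prod_roots_int Dp.
  by rewrite prodf_seq_neq0; apply/allP=> r /R0.
have HI : `|\prod_(r <- rs) zeval r H| = 1.
  have [z zA] := Aunit_prod (fun r rin => Hu r (prs r rin)).
  have /intrP[k ->] := prod_roots_int H Dp.
  by move=> /(Aint_dvd1_int zA) k1; rewrite -intr_norm k1.
(* Since 1/r is the conjugate of r, each |H(r) - H(1/r)| is at most 2 |H(r)|. Taking products, with
   |N(R)| >= 1 and |N(H)| = 1, gives 2^(e phi(n)) <= 2^phi(n), which is false for e >= 2. *)
have : \prod_(r <- rs) `|2 ^+ e * zeval r R| <= \prod_(r <- rs) (2 * `|zeval r H|) :> algC.
  rewrite big_seq [leRHS]big_seq; apply: ler_prod => r rin; rewrite normr_ge0 /=.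
  rewrite -HR // mulr2n mulrDl mul1r -{2}(Hconj _ rin); exact: ler_normB.
have constX (t : algC) : \prod_(r <- rs) t = t ^+ size rs.
  by elim: (rs) => [|r s IH]; rewrite ?big_nil ?expr0 // big_cons exprS IH.
rewrite [leRHS]big_split /= -(normr_prod _ _ (fun r => zeval r H)) HI mulr1.
under eq_bigr do rewrite normrM normrX normr_nat.
rewrite big_split /= -normr_prod !constX => /(le_trans _) le1.
have /le1 : (2 ^+ e) ^+ size rs <= (2 ^+ e) ^+ size rs * `|\prod_(r <- rs) zeval r R| :> algC.
  by rewrite ler_peMr // ?exprn_ge0 ?exprn_ge0 ?ler0n.
move=> le2; suff /lt_le_trans/(_ le2) : 2 ^+ size rs < (2 ^+ e) ^+ size rs :> algC.
  by rewrite ltxx.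
rewrite ltr_pXn2r -?lt0n ?nnegrE ?exprn_ge0 ?ler0n //.
by rewrite -[ltLHS]expr1 ltr_eXn2l // ltr1n.
Qed.

(** * Moebius inversion *)

Lemma perm_divisors_dvd n k : (0 < n)%N -> (k %| n)%N ->
  perm_eq [seq d <- divisors n | (d %| k)%N] (divisors k).
Proof.
move=> n0 kn; have k0 := dvdn_gt0 n0 kn.
apply: uniq_perm; rewrite ?filter_uniq ?divisors_uniq // => d.
rewrite mem_filter -!dvdn_divisors //.
by case: (boolP (d %| k)%N) => // dk; rewrite (dvdn_trans dk kn).
Qed.

Lemma perm_divisors_multiples n k : (0 < n)%N -> (k %| n)%N ->
  perm_eq [seq d <- divisors n | (k %| d)%N] [seq (k * e)%N | e <- divisors (n %/ k)].
Proof.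
move=> n0 kn; have k0 := dvdn_gt0 n0 kn.
have nk0 : (0 < n %/ k)%N by rewrite divn_gt0 // dvdn_leq.
apply: uniq_perm; first by rewrite filter_uniq ?divisors_uniq.
  rewrite map_inj_uniq ?divisors_uniq // => x y /eqP.
  by rewrite eqn_pmul2l // => /eqP.
move=> d; rewrite mem_filter -dvdn_divisors //; apply/andP/mapP.
  case=> /dvdnP[e ->] dn; exists e; last exact: mulnC.
  by rewrite -dvdn_divisors // dvdn_divRL.
case=> e; rewrite -dvdn_divisors // dvdn_divRL // => en ->.
by rewrite dvdn_mulr // mulnC.
Qed.

Lemma moebius_prime_mul p e : prime p -> (0 < e)%N ->
  moebius (p * e) = if (p %| e)%N then 0 else - moebius e.
Proof.
move=> pp e0; have p0 := prime_gt0 pp; have pe0 : (0 < p * e)%N by rewrite muln_gt0 p0.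
case: ifPn => pe.
  rewrite /moebius ifF //; apply/negbTE/allPn; exists p.
    by rewrite mem_primes pp pe0 dvdn_mulr.
  by rewrite lognM // logn_prime // eqxx -lt0n -pfactor_dvdn // expn1 in pe *.
have perm : perm_eq (primes (p * e)) (p :: primes e).
  apply: uniq_perm; rewrite ?primes_uniq //=.
    by rewrite primes_uniq andbT mem_primes negb_and negb_and pe !orbT.
  by move=> q; rewrite primesM // primes_prime // !inE.
rewrite /moebius (perm_all _ perm) (perm_size perm) /=.
rewrite lognM // logn_prime // eqxx.
have -> : logn p e = 0%N by apply/eqP; rewrite -leqn0 leqNgt -pfactor_dvdn // expn1.
rewrite /= (@eq_in_all _ _ (fun q => logn q e == 1%N)); last first.
  move=> q; rewrite mem_primes => /and3P[pq _ qe].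
  rewrite lognM // logn_prime //; case: (eqVneq q p) => // qp.
  by rewrite -qp qe in pe.
by case: ifP => _; rewrite ?oppr0 // exprS mulN1r.
Qed.

(** For a prime p dividing n, the divisors d prime to p cancel against the divisors pd; the
    multiples of p^2 contribute 0. *)
Lemma sum_moebius n : (0 < n)%N ->
  \sum_(d <- divisors n) moebius d = (n == 1%N)%:R.
Proof.
move=> n0; have [->|n1] := eqVneq n 1%N; first by rewrite big_seq1.
have n_gt1 : (1 < n)%N by lia.
have pp := pdiv_prime n_gt1; have pn := pdiv_dvd n.
set p := pdiv n in pp pn.
have np0 : (0 < n %/ p)%N by rewrite divn_gt0 ?prime_gt0 // dvdn_leq.
rewrite (bigID (fun d => (p %| d)%N)) /= -big_filter.
rewrite (perm_big _ (perm_divisors_multiples n0 pn)) /=.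
rewrite big_map /= big_seq.
under eq_bigr => e.
  rewrite -dvdn_divisors // => en; rewrite (moebius_prime_mul pp (dvdn_gt0 np0 en)) -if_neg.
  over.
rewrite -big_seq -big_mkcond /= sumrN.
suff -> : \sum_(d <- divisors n | ~~ (p %| d)%N) moebius d =
  \sum_(e <- divisors (n %/ p) | ~~ (p %| e)%N) moebius e by rewrite addNr.
rewrite -big_filter -[RHS]big_filter; apply: perm_big.
apply: uniq_perm; rewrite ?filter_uniq ?divisors_uniq // => d.
rewrite !mem_filter -!dvdn_divisors //; case: (boolP (p %| d)%N) => //= pd.
rewrite -{1}(divnK pn) Gauss_dvdl // coprime_sym prime_coprime //.
Qed.

(** After exchanging the products, g d carries the sum of mu(n/k) over the k with d | k | n, which
    is the sum of mu over the divisors of n/d and vanishes unless d = n. *)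
Lemma moebius_inversion (F : fieldType) (f g : nat -> F) n : (0 < n)%N ->
    (forall d, (d %| n)%N -> g d != 0) ->
    (forall k, (k %| n)%N -> f k = \prod_(d <- divisors k) g d) ->
  \prod_(k <- divisors n) f k ^ moebius (n %/ k) = g n.
Proof.
move=> n0 g0 fg.
transitivity (\prod_(k <- divisors n) \prod_(d <- divisors n | (d %| k)%N)
    g d ^ moebius (n %/ k)).
  rewrite big_seq [RHS]big_seq; apply: eq_bigr => k; rewrite -dvdn_divisors // => kn.
  rewrite fg // -(perm_big _ (perm_divisors_dvd n0 kn)) big_filter.
  by rewrite (big_morph (fun x => x ^ _) (fun x y => expfzMl x y _) (exp1rz _ _)).
rewrite (exchange_big_dep predT) //=.
rewrite (big_rem n) ?divisors_id //= [X in _ * X]big1_seq ?mulr1.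
  rewrite -big_filter (perm_big _ (perm_divisors_multiples n0 (dvdnn n))) /=.
  by rewrite divnn n0 big_map big_seq1 muln1 divnn n0 expr1z.
move=> d /=; rewrite mem_rem_uniq ?divisors_uniq // !inE -dvdn_divisors // => /andP[dn' dn].
transitivity (g d ^ (\sum_(k <- divisors n | (d %| k)%N) moebius (n %/ k))).
  rewrite (big_morph (fun m => g d ^ m) (id1 := 1) (op1 := *%R)) ?expr0z //.
  by move=> a b; rewrite expfzDr // g0.
have d0 := dvdn_gt0 n0 dn.
have nd0 : (0 < n %/ d)%N by rewrite divn_gt0 // dvdn_leq.
have divnn_id x : (x %| n)%N -> (n %/ (n %/ x) = x)%N.
  move=> xn; have x0 := dvdn_gt0 n0 xn.
  by rewrite -{1}(divnK xn) mulKn // divn_gt0 // dvdn_leq.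
(* The involution k -> n/k carries the multiples of d among the divisors of n onto the divisors of
   n/d. *)
rewrite -big_filter -(big_map (fun k => n %/ k)%N xpredT moebius).
rewrite (perm_big (divisors (n %/ d))); last first.
  apply: uniq_perm; rewrite ?divisors_uniq //.
    rewrite map_inj_in_uniq ?filter_uniq ?divisors_uniq // => x y.
    rewrite !mem_filter -!dvdn_divisors // => /andP[_ xn] /andP[_ yn] e.
    by rewrite -(divnn_id x) // -(divnn_id y) // e.
  move=> e; rewrite -dvdn_divisors //; apply/mapP/idP.
    case=> k; rewrite mem_filter -dvdn_divisors // => /andP[dk kn] ->.
    rewrite dvdn_divRL //; apply/dvdnP; exists (k %/ d)%N.
    by rewrite mulnCA mulnC divnK // mulnC divnK.
  rewrite dvdn_divRL // => edn.
  have en : (e %| n)%N := dvdn_trans (dvdn_mulr d (dvdnn e)) edn.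
  exists (n %/ e)%N; last by rewrite divnn_id.
  by rewrite mem_filter -dvdn_divisors // dvdn_div // dvdn_divRL // mulnC edn.
rewrite sum_moebius //; case: eqP; last by rewrite expr0z.
move=> e1; move: dn'; rewrite -[n](divnK dn) e1 mul1n eqxx //.
Qed.

(** * Factorization of a sequence of polynomials by level *)

Definition zroots (p : {poly int}) : seq algC :=
  sval (closed_field_poly_normal (map_poly intr p)).

Lemma zrootsE p : p \is monic ->
  map_poly intr p = \prod_(c <- zroots p) ('X - c%:P) :> {poly algC}.
Proof.
rewrite /zroots; case: closed_field_poly_normal => rs /= {1}-> mp.
by rewrite lead_coef_map_inj ?(monicP mp) ?scale1r //; exact: intr_inj.
Qed.

Lemma mem_zroots p c : p \is monic -> (c \in zroots p) = (zeval c p == 0).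
Proof. by move=> mp; rewrite -root_prod_XsubC -zrootsE. Qed.

Lemma zroots_uniq p : p \is monic ->
  (forall c : algC, zeval c p = 0 -> zeval c p^`() != 0) -> uniq (zroots p).
Proof.
move=> mp sep; rewrite -separable_prod_XsubC -zrootsE // unlock.
apply/Pdiv.ClosedField.coprimepP => x /eqP/sep.
by rewrite /zeval deriv_map.
Qed.

(** What a_k and u_k have in common. The last field makes the set of indices that vanish at c stable
    under translation by any of its members, in both directions. *)
Record level_sequence (s : nat -> {poly int}) : Prop := LevelSequence {
  level_monic : forall k, (0 < k)%N -> s k \is monic;
  level_simple : forall k (c : algC), (0 < k)%N ->
    zeval c (s k) = 0 -> zeval c (s k)^`() != 0;
  level_periodic : forall k l (c : algC), (0 < k)%N -> (0 < l)%N ->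
    zeval c (s k) = 0 -> (zeval c (s (k + l)%N) == 0) = (zeval c (s l) == 0) }.

(** For n > 0 and s = [corb], this says that 0 has exact period n under z^2 + c. *)
Definition exact_level (s : nat -> {poly int}) n (c : algC) :=
  (zeval c (s n) == 0) && all (fun j => zeval c (s j) != 0) (iota 1 n.-1).

Lemma exact_levelP s n (c : algC) : reflect
  (zeval c (s n) = 0 /\ forall j, (0 < j < n)%N -> zeval c (s j) != 0)
  (exact_level s n c).
Proof.
apply: (iffP andP) => [[/eqP sn /allP h]|[sn h]]; split=> //.
- by move=> j jn; apply: h; rewrite mem_iota; lia.
- exact/eqP.
by apply/allP=> j; rewrite mem_iota => jn; apply: h; lia.
Qed.

(** As in Euclid's algorithm, subtracting j from k preserves both sides, until k <= j. *)
Lemma exact_level_dvd s (j k : nat) (c : algC) :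
    level_sequence s -> (0 < j)%N -> (0 < k)%N -> exact_level s j c ->
  (zeval c (s k) == 0) = (j %| k)%N.
Proof.
move=> hs j0 k0 /exact_levelP[sj nj]; elim/ltn_ind: k k0 => k IH k0.
have [kj|jk|->] := ltngtP k j.
- rewrite (negbTE (nj _ _)) ?k0 //; apply/esym/negbTE/negP=> /(dvdn_leq k0).
  by rewrite leqNgt kj.
- rewrite -{1}(subnKC (ltnW jk)) (level_periodic hs) ?subn_gt0 //.
  have lt : (k - j < k)%N by lia.
  by rewrite IH ?subn_gt0 // dvdn_subl // ltnW.
- by rewrite sj eqxx dvdnn.
Qed.

Lemma exact_level_exists s n (c : algC) :
    level_sequence s -> (0 < n)%N -> zeval c (s n) = 0 ->
  exists j, [/\ (0 < j)%N, (j %| n)%N & exact_level s j c].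
Proof.
move=> hs n0 sn; pose P j := (0 < j)%N && (zeval c (s j) == 0).
have exP : exists j, P j by exists n; rewrite /P n0 sn eqxx.
case: (ex_minnP exP) => j /andP[j0 /eqP sj] jmin.
have ej : exact_level s j c.
  apply/exact_levelP; split=> // i ij; apply/negP=> si.
  have := jmin i; rewrite /P si andbT; lia.
by exists j; rewrite -(exact_level_dvd hs j0 n0 ej) sn eqxx.
Qed.
Lemma exact_level_inj s i j (c : algC) :
    level_sequence s -> (0 < i)%N -> (0 < j)%N ->
  exact_level s i c -> exact_level s j c -> i = j.
Proof.
move=> hs i0 j0 ei ej; apply/eqP; rewrite eqn_dvd.
rewrite -(exact_level_dvd hs i0 j0 ei) -(exact_level_dvd hs j0 i0 ej).
by move/exact_levelP: ei => [-> _]; move/exact_levelP: ej => [-> _]; rewrite eqxx.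
Qed.

Definition exact_roots s n : seq algC := [seq c <- zroots (s n) | exact_level s n c].

(** These are W_n for u_k and V_n, the Gleason polynomial, for a_k. [Num.floor] only transports the
    coefficients to Z; they are shown to be integers in [level_partE]. *)
Definition level_part (s : nat -> {poly int}) n : {poly int} :=
  map_poly Num.floor (\prod_(c <- exact_roots s n) ('X - c%:P)).

Lemma mem_exact_roots s n c : level_sequence s -> (0 < n)%N ->
  (c \in exact_roots s n) = exact_level s n c.
Proof.
move=> hs n0; rewrite mem_filter mem_zroots ?(level_monic hs) //.
by case: exact_levelP => // -[-> _]; rewrite eqxx.
Qed.

Lemma exact_roots_uniq s n : level_sequence s -> (0 < n)%N ->
  uniq (exact_roots s n).
Proof.
move=> hs n0; apply/filter_uniq/zroots_uniq; first exact: level_monic.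
by move=> c; apply: (level_simple hs).
Qed.

(** The roots of s n are simple, and each has exactly one level, a divisor of n; the product is
    grouped by level. *)
Lemma prod_exact_roots s n : level_sequence s -> (0 < n)%N ->
  map_poly intr (s n) =
  \prod_(d <- divisors n) \prod_(c <- exact_roots s d) ('X - c%:P) :> {poly algC}.
Proof.
move=> hs n0.
transitivity (\prod_(d <- divisors n) \prod_(c <- zroots (s n) | exact_level s d c)
    ('X - c%:P) : {poly algC}); last first.
  rewrite big_seq [RHS]big_seq; apply: eq_bigr => d; rewrite -dvdn_divisors // => dn.
  have d0 := dvdn_gt0 n0 dn; rewrite -big_filter; apply: perm_big.
  apply: uniq_perm; rewrite ?exact_roots_uniq //.
    by apply/filter_uniq/zroots_uniq=> [|c]; [exact: level_monic|exact: level_simple].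
  move=> c; rewrite mem_exact_roots // mem_filter mem_zroots ?(level_monic hs) //.
  by case: (boolP (exact_level s d c)) => //= ed; rewrite (exact_level_dvd hs d0).
rewrite zrootsE ?(level_monic hs) // (exchange_big_dep predT) //=.
rewrite big_seq [RHS]big_seq; apply: eq_bigr => c.
rewrite mem_zroots ?(level_monic hs) // => /eqP sn.
have [j [j0 jn ej]] := exact_level_exists hs n0 sn.
rewrite -big_filter (@eq_in_filter _ _ (pred1 j)).
  by rewrite filter_pred1_uniq ?divisors_uniq -?dvdn_divisors // big_seq1.
move=> d; rewrite -dvdn_divisors // => dn /=; apply/idP/eqP=> [ed|-> //].
by apply: (exact_level_inj hs) ed ej => //; exact: dvdn_gt0 dn.
Qed.

(** By strong induction the parts of the proper divisors are monic over Z, so their product divides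
    s n with a quotient over Z. *)
Lemma level_partE s n : level_sequence s -> (0 < n)%N ->
  map_poly intr (level_part s n) =
  \prod_(c <- exact_roots s n) ('X - c%:P) :> {poly algC}.
Proof.
move=> hs; elim/ltn_ind: n => n IH n0.
have := prod_exact_roots hs n0; rewrite (big_rem n) ?divisors_id //=.
have Dq : \prod_(d <- rem n (divisors n)) \prod_(c <- exact_roots s d) ('X - c%:P)
    = map_poly intr (\prod_(d <- rem n (divisors n)) level_part s d).
  rewrite rmorph_prod big_seq [RHS]big_seq; apply: eq_bigr => d /=.
  rewrite mem_rem_uniq ?divisors_uniq // !inE -dvdn_divisors // => /andP[dn' dn].
  by rewrite IH ?(dvdn_gt0 n0 dn) // ltn_neqAle dn' dvdn_leq.
rewrite Dq; case/monic_int_quotient => [||r _ E].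
- exact: intr_inj.
- by rewrite -monic_map_intr -Dq monic_prod // => d _; apply: monic_prod_XsubC.
by rewrite floorpK E //; apply/polyOverP=> i; rewrite coef_map /= intr_int.
Qed.

Lemma level_part_monic s n : level_sequence s -> (0 < n)%N ->
  level_part s n \is monic.
Proof. by move=> hs n0; rewrite -monic_map_intr level_partE // monic_prod_XsubC. Qed.

Lemma prod_level_part s n : level_sequence s -> (0 < n)%N ->
  s n = \prod_(d <- divisors n) level_part s d.
Proof.
move=> hs n0; apply: (map_inj_poly (@intr_inj algC)); first exact: rmorph0.
rewrite prod_exact_roots // rmorph_prod big_seq [RHS]big_seq.
by apply: eq_bigr => d /=; rewrite -dvdn_divisors // => dn; rewrite level_partE // (dvdn_gt0 n0 dn).
Qed.

Lemma level_part_dvd s t n : level_sequence s -> level_sequence t -> (0 < n)%N ->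
    (forall c, exact_level s n c -> exact_level t n c) ->
  exists q, level_part t n = q * level_part s n.
Proof.
move=> hs ht n0 st.
have /dvdpP[q Dq] : map_poly (intr : int -> algC) (level_part s n) %|
    map_poly intr (level_part t n).
  rewrite !level_partE //; apply: uniq_roots_dvdp.
    apply/allP=> c; rewrite mem_exact_roots // => /st.
    by rewrite -mem_exact_roots // root_prod_XsubC.
  by rewrite uniq_rootsE exact_roots_uniq.
have [r Er _] := monic_int_quotient (@intr_inj algC) (level_part_monic hs n0) Dq.
by exists r.
Qed.

(** * The critical orbit *)

Definition corb (i : nat) : {poly int} := iter i (fun z => z ^+ 2 + 'X) 0.

Arguments corb : simpl never.

Lemma corbS i : corb i.+1 = corb i ^+ 2 + 'X. Proof. by []. Qed.

Lemma corb1 : corb 1 = 'X. Proof. by rewrite corbS expr0n add0r. Qed.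

Lemma map_corb i : map_poly intr (corb i) = crit_orbit i.
Proof.
elim: i => [|i IH]; first by rewrite rmorph0.
by rewrite corbS rmorphD rmorphXn /= IH map_polyX.
Qed.

Lemma zeval_corbS (R : comNzRingType) (c : R) i :
  zeval c (corb i.+1) = zeval c (corb i) ^+ 2 + c.
Proof. by rewrite corbS !zevalE. Qed.

Lemma size_monic_corb i : size (corb i.+1) = (2 ^ i).+1 /\ corb i.+1 \is monic.
Proof.
elim: i => [|i [IHs IHm]]; first by rewrite corb1 size_polyX monicX.
have sq : size (corb i.+1 ^+ 2) = (2 ^ i.+1).+1.
  by rewrite expr2 size_Mmonic ?monic_neq0 // IHs expnS; lia.
have lt : (size ('X : {poly int}) < size (corb i.+1 ^+ 2))%N.
  by rewrite sq size_polyX expnS; have := expn_gt0 2 i; lia.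
by rewrite (corbS i.+1) size_polyDl // monicE lead_coefDl // (monicP (monic_exp _ IHm)).
Qed.

Lemma size_corb i : size (corb i.+1) = (2 ^ i).+1.
Proof. by case: (size_monic_corb i). Qed.

Lemma corb_monic i : (0 < i)%N -> corb i \is monic.
Proof. by case: i => // i _; case: (size_monic_corb i). Qed.

Lemma deriv_corbS i : (corb i.+1)^`() = 2 * (corb i * (corb i)^`()) + 1.
Proof. by rewrite corbS derivD derivX deriv_exp expr1 -mulr_natl mulrC; ring. Qed.

(** The derivative of a_i is 1 modulo 2 for i > 0, and a_0 = 0. *)
Lemma corb_deriv i : exists w, corb i * (corb i)^`() = corb i + 2 * w.
Proof.
case: i => [|i]; first by exists 0; rewrite mul0r mulr0 addr0.
by exists (corb i.+1 * (corb i * (corb i)^`())); rewrite deriv_corbS; ring.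
Qed.

Lemma zeval_corb_periodic (R : comNzRingType) (c : R) i j :
  zeval c (corb i) = zeval c (corb j) ->
  forall l, zeval c (corb (i + l)) = zeval c (corb (j + l)).
Proof.
by move=> e; elim=> [|l IH]; rewrite ?addn0 // !addnS !zeval_corbS IH.
Qed.

(** Roots are simple because the derivative 2 a a' + 1 is odd. If a_k(c) = 0, the orbit of 0 starts
    again after k steps. *)
Lemma corb_level_sequence : level_sequence corb.
Proof.
split=> [|k c|k l c _ _ ck]; first exact: corb_monic.
  case: k => // k _ ck; have cA := monic_int_root_Aint (corb_monic (ltn0Sn k)) ck.
  rewrite deriv_corbS !zevalE; apply/eqP=> /eqP; rewrite addrC addr_eq0 => /eqP.
  rewrite -mulrN; apply: Aint_half_absurd.
  by rewrite rpredN rpredM // zeval_Aint.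
have e : zeval c (corb k) = zeval c (corb 0) by rewrite ck zeval0.
by rewrite (zeval_corb_periodic e).
Qed.

(** This is u_k with M = m - 1. At a root, a_(M+k) = -a_M, so the critical orbit repeats with period
    k from a_(M+1) on. *)
Definition preper (M k : nat) : {poly int} := corb (M + k) + corb M.

Lemma map_preper M k :
  map_poly intr (preper M k) = crit_orbit (M + k) + crit_orbit M.
Proof. by rewrite -!map_corb; exact: rmorphD. Qed.

Lemma preper_monic M k : (0 < k)%N -> preper M k \is monic.
Proof.
case: k => // k _; rewrite /preper addnS monicE lead_coefDl.
  exact: corb_monic.
case: M => [|M]; first by rewrite size_poly0 size_corb.
by rewrite !size_corb ltnS ltn_exp2l // addSn ltnS leq_addr.
Qed.

Lemma zeval_preper_periodic (R : comNzRingType) (c : R) M k l :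
    (0 < l)%N -> zeval c (preper M k) = 0 ->
  zeval c (preper M (k + l)) = zeval c (preper M l).
Proof.
case: l => // l _; rewrite /preper !zevalD => /eqP; rewrite addr_eq0 => /eqP e.
have e' : zeval c (corb (M + k).+1) = zeval c (corb M.+1).
  by rewrite !zeval_corbS e sqrrN.
have := zeval_corb_periodic e' l.
by rewrite -!addSnnS !addSn addnA => ->.
Qed.

(* The derivative is twice a number which is odd at every root. *)
Lemma preper_level_sequence M : (0 < M)%N -> level_sequence (preper M).
Proof.
case: M => // q _; split=> [k|k c k0 ck|k l c _ l0 ck]; first exact: preper_monic.
  have cA := monic_int_root_Aint (preper_monic _ k0) ck.
  move: ck; rewrite /preper addSn; set p := (q + k)%N.
  have [wp Dp] := corb_deriv p; have [wq Dq] := corb_deriv q.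
  rewrite derivD !deriv_corbS Dp Dq zevalD !zeval_corbS !zevalE => ck.
  have := zeval_Aint wp cA; have := zeval_Aint wq cA.
  have := zeval_Aint (corb p) cA; have := zeval_Aint (corb q) cA.
  move: (zeval c (corb p)) (zeval c (corb q)) (zeval c wp) (zeval c wq) ck.
  move=> x y v w ck yA xA wA vA; apply/eqP=> e.
  have e1 : 2 * (1 + (x + y) + 2 * (v + w)) = 0 by rewrite -[RHS]e; ring.
  have {e1} e1 : x + y = - (1 + 2 * (v + w)).
    move/eqP: e1; rewrite mulf_eq0 pnatr_eq0 /= addrAC addrC addr_eq0.
    by move/eqP.
  have e2 : (x + y) ^+ 2 = 2 * (x * y - c).
    have -> : (x + y) ^+ 2 = (x ^+ 2 + c + (y ^+ 2 + c)) + 2 * (x * y - c) by ring.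
    by rewrite ck add0r.
  have : 1 = 2 * (x * y - c - 2 * (v + w) - 2 * (v + w) ^+ 2).
    rewrite !mulrBr -mulrBr -e2 e1; ring.
  by apply: Aint_half_absurd; rewrite !(rpredB, rpredM, rpredX, rpredD, rpred_nat).
by rewrite zeval_preper_periodic.
Qed.

(** Here a_M(c) = 0, so u_k(c) = a_(M+k)(c), which vanishes exactly when n | k. Hence V_n divides
    W_n when n | M. *)
Lemma exact_level_corb_preper M n (c : algC) : (0 < M)%N -> (0 < n)%N ->
  (n %| M)%N -> exact_level corb n c -> exact_level (preper M) n c.
Proof.
move=> M0 n0 nM en.
have ck k : (0 < k)%N -> (zeval c (preper M k) == 0) = (n %| k)%N.
  have /eqP cM : zeval c (corb M) == 0.
    by rewrite (exact_level_dvd corb_level_sequence n0 M0 en).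
  move=> k0; rewrite /preper zevalD cM addr0.
  by rewrite (exact_level_dvd corb_level_sequence n0 _ en) ?addn_gt0 ?M0 // dvdn_addr.
apply/exact_levelP; split; first by apply/eqP; rewrite ck.
move=> j /andP[j0 jn]; rewrite ck //; apply/negP=> /(dvdn_leq j0).
by rewrite leqNgt jn.
Qed.

Lemma prod_tofrac_level_part s n : level_sequence s -> (0 < n)%N ->
  \prod_(k <- divisors n) tofrac (map_poly (intr : int -> rat) (s k)) ^ moebius (n %/ k)
  = tofrac (map_poly intr (level_part s n)).
Proof.
move=> hs n0.
apply: (@moebius_inversion _ _ (fun k => tofrac (map_poly intr (level_part s k)))) => // k kn.
  rewrite tofrac_eq0 monic_neq0 // monic_map // level_part_monic //.
  exact: dvdn_gt0 n0 kn.
by rewrite (prod_level_part hs (dvdn_gt0 n0 kn)) !rmorph_prod.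
Qed.

(** Moebius inversion turns the main product into W_n and the correction epsilon into 1/V_n, an
    exact division in Z[X]. *)
Lemma misiurewicz_level_part m n : (2 <= m)%N -> (0 < n)%N ->
  exists2 g : {poly int}, misiurewicz m n = map_poly intr g &
    level_part (preper m.-1) n = g * (if (n %| m.-1)%N then level_part corb n else 1).
Proof.
case: m => [|[|M]] // _ n0; rewrite [_.+2.-1]/=.
have hu := @preper_level_sequence M.+1 isT; have hc := corb_level_sequence.
suff [g Dg Eg] : exists2 g : {poly int},
    misiurewicz_frac M.+2 n = tofrac (map_poly intr g) &
    level_part (preper M.+1) n = g * (if (n %| M.+1)%N then level_part corb n else 1).
  by exists g => //; rewrite /misiurewicz Dg frac_polyK.
rewrite /misiurewicz_frac.
have -> : \prod_(k <- divisors n) tofrac (crit_orbit (M.+2 + k - 1)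
    + crit_orbit (M.+2 - 1)) ^ moebius (n %/ k)
  = tofrac (map_poly intr (level_part (preper M.+1) n)).
  rewrite -prod_tofrac_level_part //; apply: eq_bigr => k _.
  by rewrite map_preper !subn1 addSn !succnK.
rewrite subn1 succnK; case: ifP => nM; last first.
  by exists (level_part (preper M.+1) n); rewrite ?mulr1.
have [g Dg] := level_part_dvd hc hu n0 (fun c => @exact_level_corb_preper M.+1 n c isT n0 nM).
exists g => //; rewrite Dg rmorphM /= rmorphM /= -[RHS]mulr1 -mulrA; congr (_ * _).
have V0 : tofrac (map_poly (intr : int -> rat) (level_part corb n)) != 0.
  by rewrite tofrac_eq0 monic_neq0 // monic_map // level_part_monic.
under eq_bigr do rewrite -map_corb -invr_expz.
by rewrite prodfV prod_tofrac_level_part // divff.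
Qed.

(** * Multipliers at the roots of level 1 and 2 *)

Lemma prod_divisors_gt1 (R : comPzSemiRingType) (F : nat -> R) k : (0 < k)%N ->
  \prod_(d <- divisors k) F d = F 1%N * \prod_(d <- divisors k | (1 < d)%N) F d.
Proof.
move=> k0; rewrite (big_rem 1%N) -?dvdn_divisors //=; congr (_ * _).
rewrite rem_filter ?divisors_uniq // big_filter big_seq_cond [RHS]big_seq_cond.
apply: eq_bigl => d; rewrite -dvdn_divisors //.
by case: (boolP (d %| k)%N) => //= /(dvdn_gt0 k0) d0; lia.
Qed.

(** Strong induction cancels the factors of the proper divisors. The divisor 1 is left out because
    its factor may vanish in the applications. *)
Lemma divisor_prod_inj (R : idomainType) (f g : nat -> R) (P : pred nat) :
    (forall d k, (d %| k)%N -> P k -> P d) ->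
    (forall k, (0 < k)%N -> P k -> \prod_(d <- divisors k | (1 < d)%N) f d =
      \prod_(d <- divisors k | (1 < d)%N) g d) ->
    (forall k, (0 < k)%N -> P k -> \prod_(d <- divisors k | (1 < d)%N) f d != 0) ->
  forall n, (1 < n)%N -> P n -> f n = g n.
Proof.
move=> Pd fg f0; elim/ltn_ind => n IH n1 Pn; have n0 := ltnW n1.
have := f0 n n0 Pn; have := fg n n0 Pn.
rewrite !(big_rem n (divisors_id n0)) /= n1 => E; rewrite mulf_eq0 negb_or => /andP[_ r0].
apply: (mulIf r0); rewrite E; congr (_ * _); rewrite big_seq_cond [RHS]big_seq_cond.
apply: eq_bigr => d; rewrite mem_rem_uniq ?divisors_uniq // !inE -dvdn_divisors //.
move=> /andP[/andP[dn' dn] d1]; rewrite IH ?(Pd _ _ dn) //.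
by rewrite ltn_neqAle dn' dvdn_leq.
Qed.

Lemma prod_Cyclotomic_gt1 (R : comNzRingType) (x : R) k : (0 < k)%N ->
  \prod_(d <- divisors k | (1 < d)%N) zeval x 'Phi_d = \sum_(i < k) x ^+ i.
Proof.
move=> k0; have P1 : 'Phi_1 = 'X - 1.
  by have := prod_Cyclotomic (ltn0Sn 0); rewrite big_seq1 expr1.
have X0 : 'X - 1 != 0 :> {poly int} by rewrite monic_neq0 // -[1]/(1%:P) monicXsubC.
have : \prod_(d <- divisors k | (1 < d)%N) 'Phi_d = \sum_(i < k) 'X^i.
  by apply: (mulfI X0); rewrite -subrX1 -prod_Cyclotomic // prod_divisors_gt1 // P1.
move/(congr1 (zeval x)); rewrite rmorph_prod raddf_sum /= => ->.
by apply: eq_bigr => i _; rewrite !zevalE.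
Qed.

(** The difference u_(k+1) - u_1 is the difference of squares a_(M+k)^2 - a_M^2. *)
Lemma preperS M k : preper M k.+1 =
  preper M 1 + preper M k * (preper M k - 2 * corb M).
Proof. rewrite /preper addnS addn1 !corbS; ring. Qed.

Lemma preper_neq0 M k : (0 < k)%N -> preper M k != 0.
Proof. by move=> k0; rewrite monic_neq0 ?preper_monic. Qed.

Lemma level_part1 s : level_sequence s -> level_part s 1 = s 1%N.
Proof. by move=> hs; rewrite [RHS]prod_level_part // big_seq1. Qed.

Lemma zeval_simple_cofactor s k (c : algC) p q : level_sequence s -> (0 < k)%N ->
  s k = p * q -> zeval c p = 0 -> zeval c q != 0.
Proof.
move=> hs k0 spq pc; apply/eqP=> qc.
have sk : zeval c (s k) = 0 by rewrite spq zevalM pc mul0r.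
have /negP[] := level_simple hs k0 sk.
by rewrite spq derivM zevalD !zevalM pc qc mulr0 mul0r addr0.
Qed.

(** At a root of u_1 the point -a_M is fixed, with multiplier l = -2 a_M. The recursion for v_k =
    u_k / u_1 makes v_k(c) the geometric sum of ratio l, which is the product of Phi_d(l) over the
    divisors d > 1 of k; the factors are then compared. *)
Lemma zeval_level_part_fixed M n (c : algC) : (0 < M)%N -> (1 < n)%N ->
    zeval c (preper M 1) = 0 ->
  zeval c (level_part (preper M) n) = zeval (- (2 * zeval c (corb M))) 'Phi_n.
Proof.
move=> M0 n1 c1; have hs := preper_level_sequence M0.
set l := - _; pose v k := \prod_(d <- divisors k | (1 < d)%N) level_part (preper M) d.
have uv k : (0 < k)%N -> preper M k = preper M 1 * v k.
  by move=> k0; rewrite (prod_level_part hs k0) prod_divisors_gt1 // level_part1.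
have v1 : v 1%N = 1 by rewrite /v big_cons big_nil.
have vS k : (0 < k)%N -> v k.+1 = 1 + v k * (preper M k - 2 * corb M).
  move=> k0; apply: (mulfI (preper_neq0 M (ltn0Sn 0))).
  by rewrite -uv // mulrDr mulr1 mulrA -uv // preperS.
have vc k : (0 < k)%N -> zeval c (v k) = \sum_(i < k) l ^+ i.
  case: k => // k _; elim: k => [|k IH]; first by rewrite v1 big_ord1 zeval1 expr0.
  rewrite vS // zevalD zeval1 zevalM IH [RHS]big_ord_recl expr0; congr (_ + _).
  rewrite zevalD zevalN (uv k.+1) // zevalM c1 mul0r add0r zevalM.
  rewrite (_ : zeval c 2 = 2) ?(rmorph_nat (zeval c)) // -/l mulrC mulr_sumr.
  by apply: eq_bigr => i _; rewrite -exprS.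
have vE k : \prod_(d <- divisors k | (1 < d)%N) zeval c (level_part (preper M) d)
    = zeval c (v k) by rewrite rmorph_prod.
apply: (@divisor_prod_inj _ (fun d => zeval c (level_part (preper M) d))
   (fun d => zeval l 'Phi_d) predT) => // k k0 _; rewrite vE.
  by rewrite prod_Cyclotomic_gt1 // vc.
exact: (zeval_simple_cofactor hs k0 (uv k k0)).
Qed.

Lemma level_part2 M : (0 < M)%N ->
  level_part (preper M) 2 = corb M.+1 - corb M + 1.
Proof.
move=> M0; have hs := preper_level_sequence M0.
apply: (mulfI (preper_neq0 M (ltn0Sn 0))).
have := prod_level_part hs (ltn0Sn 1); rewrite (_ : divisors 2 = [:: 1; 2]%N) //.
rewrite big_cons big_seq1 level_part1 // => <-.
by rewrite preperS /preper addn1; ring.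
Qed.

Lemma zeval_level_part_cycle2 M e (c : algC) : (0 < M)%N -> (1 < e)%N ->
    zeval c (level_part (preper M) 2) = 0 ->
  zeval c (level_part (preper M) (2 * e)) = zeval (4 * (c + 1)) 'Phi_e.
Proof.
move=> M0 e1 c2; have hs := preper_level_sequence M0.
set l := 4 * _; pose W := level_part (preper M); rewrite -!/W in c2 *.
have W1 : W 1%N = preper M 1 by rewrite /W level_part1.
have u2 : preper M 2 = preper M 1 * W 2%N.
  by rewrite (prod_level_part hs (ltn0Sn 1)) (_ : divisors 2 = [:: 1; 2]%N) // big_cons big_seq1 -W1.
have c1 : zeval c (preper M 1) != 0.
  by apply: (zeval_simple_cofactor hs (ltn0Sn 1) _ c2); rewrite u2 mulrC.
have cu2 : zeval c (preper M 2) = 0 by rewrite u2 zevalM c2 mulr0.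
(* The values u_k(c) have period 2 in k, so odd indices give the nonzero u_1(c) and every W_d(c)
   with d > 1 odd must be 1. *)
have per k : zeval c (preper M k.+1) = if odd k then 0 else zeval c (preper M 1).
  elim/ltn_ind: k => -[|[|k]] IH //; rewrite -[k.+3]/(2 + k.+1)%N.
  by rewrite zeval_preper_periodic // IH //= negbK.
have Wodd d : (1 < d)%N -> odd d -> zeval c (W d) = 1.
  pose v k := \prod_(d <- divisors k | (1 < d)%N) W d.
  have v1 k : (0 < k)%N -> odd k -> zeval c (v k) = 1.
    case: k => // k _ ok; apply: (mulfI c1); rewrite -zevalM mulr1.
    rewrite -W1 -prod_divisors_gt1 // -(prod_level_part hs) // per.
    by rewrite ifN ?W1.
  have vE k : \prod_(d <- divisors k | (1 < d)%N) zeval c (W d) = zeval c (v k).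
    by rewrite rmorph_prod.
  apply: (@divisor_prod_inj _ (fun d => zeval c (W d)) (fun=> 1) odd).
  - by move=> d' k /dvdn_odd.
  - by move=> k k0 ok; rewrite vE v1 // big1.
  - by move=> k k0 ok; rewrite vE v1 // oner_eq0.
(* In u_(2i), W_1 and W_2 form u_2; [o] collects the other odd divisors and [v] the other even
   ones. *)
pose o i := \prod_(d <- divisors (2 * i) | odd d && (1 < d)%N) W d.
pose v i := \prod_(d <- divisors i | (1 < d)%N) W (2 * d)%N.
have uv i : (0 < i)%N -> preper M (2 * i) = preper M 2 * (o i * v i).
  move=> i0; have i20 : (0 < 2 * i)%N by rewrite muln_gt0.
  rewrite (prod_level_part hs i20) -/W (bigID (fun d => (2 %| d)%N)) /= -big_filter.
  rewrite (perm_big _ (perm_divisors_multiples i20 (dvdn_mulr i (dvdnn 2)))) /=.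
  rewrite big_map mulKn // prod_divisors_gt1 // -/(v i) muln1 u2 -W1.
  under eq_bigl do rewrite dvdn2 negbK.
  rewrite -[X in _ * X]big_filter (bigD1_seq 1%N) ?filter_uniq ?divisors_uniq //=; last first.
    by rewrite mem_filter -dvdn_divisors // dvd1n.
  rewrite big_filter_cond.
  rewrite (eq_bigl (fun d => odd d && (1 < d)%N)) -/(o i); first by ring.
  by case=> [|[|d]].
have co i : zeval c (o i) = 1.
  by rewrite /o rmorph_prod /= big1 // => d /andP[od d1]; exact: Wodd.
have ov1 : o 1%N * v 1%N = 1.
  by apply: (mulfI (preper_neq0 M (ltn0Sn 1))); rewrite -uv // muln1 mulr1.
(* Two steps of [preperS], after which u_2 is subtracted and divided out. *)
have ovS i : (0 < i)%N -> o i.+1 * v i.+1 = 1 + o i * v i *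
   ((preper M (2 * i) - 2 * corb M) * (preper M (2 * i).+1 + preper M 1 - 2 * corb M)).
  move=> i0; apply: (mulfI (preper_neq0 M (ltn0Sn 1))).
  rewrite -uv // mulrDr mulr1 mulrA -uv // mulnS !addSn add0n.
  by rewrite preperS (preperS M (2 * i)) (preperS M 1); ring.
(* The cycle consists of -a_M and a_(M+1), and its multiplier is the product of the two
   derivatives. *)
have lE : - (2 * zeval c (corb M)) * (2 * zeval c (corb M.+1)) = l.
  move: c2; rewrite /W level_part2 // zevalD zevalD zevalN zeval1 zeval_corbS /l.
  move: (zeval c (corb M)) => a E.
  have -> : c = (a ^+ 2 + c - a + 1) + (a - 1 - a ^+ 2) by ring.
  by rewrite E; ring.
have vc i : (0 < i)%N -> zeval c (v i) = \sum_(j < i) l ^+ j.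
  move=> i0; rewrite -[LHS]mul1r -(co i) -zevalM.
  case: i i0 => // i _; elim: i => [|i IH]; first by rewrite ov1 big_ord1 zeval1 expr0.
  rewrite ovS // zevalD zeval1 zevalM IH [RHS]big_ord_recl expr0; congr (_ + _).
  have -> : zeval c ((preper M (2 * i.+1) - 2 * corb M) *
     (preper M (2 * i.+1).+1 + preper M 1 - 2 * corb M)) = l.
    have z2 : zeval c 2 = 2 by rewrite (rmorph_nat (zeval c)).
    rewrite zevalM -lE; congr (_ * _).
      by rewrite [LHS]zevalD (uv i.+1) // zevalM cu2 mul0r add0r zevalN zevalM z2.
    rewrite [LHS]zevalD [X in X + _ = _]zevalD per oddM /= zevalN zevalM z2.
    by rewrite /preper addn1 zevalD; ring.
  by rewrite mulrC mulr_sumr; apply: eq_bigr => j _; rewrite -exprS.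
have vE i : \prod_(d <- divisors i | (1 < d)%N) zeval c (W (2 * d)%N) = zeval c (v i).
  by rewrite rmorph_prod.
apply: (@divisor_prod_inj _ (fun d => zeval c (W (2 * d)%N))
   (fun d => zeval l 'Phi_d) predT) => // k k0 _; rewrite vE.
  by rewrite prod_Cyclotomic_gt1 // vc.
have k20 : (0 < 2 * k)%N by rewrite muln_gt0.
have := zeval_simple_cofactor hs k20 (uv k k0) cu2.
by rewrite zevalM co mul1r.
Qed.

(** * Unit factors and rescaled orbits *)

(** Since n | M, a_M(c) = c x r with x = V_n(c). Dividing a_M^2 + a_M + c = 0 by c gives x r (c x r
    + 1) = -1. *)
Lemma Aunit_level_part_fixed M n (c : algC) : (0 < M)%N -> (1 < n)%N ->
    (n %| M)%N -> c \in Aint -> c != 0 -> zeval c (preper M 1) = 0 ->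
  Aunit (zeval c (level_part corb n)).
Proof.
move=> M0 n1 nM cA c0; have hc := corb_level_sequence.
rewrite /preper addn1 zevalD zeval_corbS.
rewrite (prod_level_part hc M0) prod_divisors_gt1 // level_part1 // corb1.
rewrite (big_rem n) -?dvdn_divisors //= n1 !zevalM zevalX.
set r := \prod_(d <- _ | _) _; set x := zeval c _ => E.
exists (- zeval c r * (c * (x * zeval c r) + 1)).
  by rewrite rpredM ?rpredN ?rpredD ?rpredM ?zeval_Aint.
apply: (mulfI c0); rewrite -[RHS]subr0 -E; ring.
Qed.

Lemma level_part_corb2 : level_part corb 2 = 'X + 1.
Proof.
have hc := corb_level_sequence.
apply: (mulfI (negbT (polyX_eq0 int))).
have := prod_level_part hc (ltn0Sn 1); rewrite (_ : divisors 2 = [:: 1; 2]%N) //.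
by rewrite big_cons big_seq1 level_part1 // corb1 => <-; rewrite corbS corb1; ring.
Qed.

(** Here a_M(c) = c (c + 1) x r with x = V_n(c). Dividing a_M^2 - a_M + c + 1 = 0 by c + 1 gives c x
    r (1 - c (c + 1) x r) = 1. *)
Lemma Aunit_level_part_cycle2 M n (c : algC) : (0 < M)%N -> (2 < n)%N ->
    (2 %| n)%N -> (n %| M)%N -> c \in Aint -> c + 1 != 0 ->
    zeval c (level_part (preper M) 2) = 0 ->
  Aunit (zeval c (level_part corb n)).
Proof.
move=> M0 n2 en nM cA c0; have hc := corb_level_sequence.
rewrite level_part2 // zevalD zevalD zevalN zeval1 zeval_corbS.
rewrite (prod_level_part hc M0) prod_divisors_gt1 // level_part1 // corb1.
rewrite (big_rem 2) -?dvdn_divisors ?(dvdn_trans en) //= level_part_corb2.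
rewrite (big_rem n) /=; last first.
  by rewrite mem_rem_uniq ?divisors_uniq // !inE -dvdn_divisors // nM andbT; lia.
rewrite (ltnW n2) !zevalM zevalD zevalX zeval1.
set r := \prod_(d <- _ | _) _; set x := zeval c _ => E.
exists (c * zeval c r * (1 - c * (c + 1) * (x * zeval c r))).
  by rewrite !(rpredM, rpredB, rpredD) ?zeval_Aint.
apply: (mulfI c0); rewrite -[RHS]subr0 -E; ring.
Qed.

Lemma Aunit_Cyclotomic n (x z : algC) : (1 < n)%N -> n.-primitive_root z ->
  x \in Aint -> Aunit (zeval x 'Phi_n) -> Aunit (x - z).
Proof.
move=> n1 pz xA; rewrite /zeval (Cintr_Cyclotomic pz) /cyclotomic horner_prod.
rewrite (bigD1 (Ordinal n1)) ?coprime1n //= hornerXsubC expr1 mulrC.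
apply: Aunit_mull; rewrite rpred_prod // => k _.
by rewrite hornerXsubC rpredB // rpredX // (Aint_prim_root pz).
Qed.

(* (2y)^(2^(i+1)) a_(i+1)(c) at the parameter c = x - x^2 of a fixed point
   x = 1/(2y), as a polynomial in y. *)
Fixpoint scaled_fixed i : {poly int} :=
  if i is j.+1 then scaled_fixed j ^+ 2 - (2 * 'X) ^+ (2 ^ j.+2 - 2) * (1 - 2 * 'X)
  else 2 * 'X - 1.

Lemma scaled_fixedS i : scaled_fixed i.+1 =
  scaled_fixed i ^+ 2 - (2 * 'X) ^+ (2 ^ i.+2 - 2) * (1 - 2 * 'X).
Proof. by []. Qed.

Lemma zeval_scaled_fixed i (y : algC) : y != 0 ->
  zeval y (scaled_fixed i) =
  (2 * y) ^+ (2 ^ i.+1) * zeval ((2 * y)^-1 - (2 * y)^-1 ^+ 2) (corb i.+1).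
Proof.
move=> y0; set x := (2 * y)^-1; have yx : 2 * y * x = 1 by rewrite divff // mulf_neq0 ?pnatr_eq0.
(* Clearing the denominator of c uses up two factors 2y, whence the exponents 2^(i+2) - 2 in
   [scaled_fixed]. *)
have y2 : (2 * y) ^+ 2 * (x - x ^+ 2) = 2 * y - 1.
  transitivity (2 * y * (2 * y * x) - (2 * y * x) ^+ 2); first by ring.
  by rewrite yx; ring.
elim: i => [|i IH]; first by rewrite corb1 !zevalE y2.
have -> : zeval y (scaled_fixed i.+1) =
    zeval y (scaled_fixed i) ^+ 2 - (2 * y) ^+ (2 ^ i.+2 - 2) * (1 - 2 * y).
  by rewrite scaled_fixedS !zevalE.
rewrite zeval_corbS IH [RHS]mulrDr exprMn -exprM -expnSr; congr (_ + _).
have {2}-> : (2 ^ i.+2 = (2 ^ i.+2 - 2) + 2)%N by rewrite subnK // !expnS; have := expn_gt0 2 i; lia.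
by rewrite exprD -mulrA y2; ring.
Qed.

(* (4y)^(2^i) a_(i+1)(c) at c = 1/(4y) - 1, where the multiplier of the 2-cycle
   is 1/y. *)
Fixpoint scaled_cycle2 i : {poly int} :=
  if i is j.+1 then scaled_cycle2 j ^+ 2 + (4 * 'X) ^+ (2 ^ j.+1 - 1) * (1 - 4 * 'X)
  else 1 - 4 * 'X.

Lemma scaled_cycle2S i : scaled_cycle2 i.+1 =
  scaled_cycle2 i ^+ 2 + (4 * 'X) ^+ (2 ^ i.+1 - 1) * (1 - 4 * 'X).
Proof. by []. Qed.

Lemma zeval_scaled_cycle2 i (y : algC) : y != 0 ->
  zeval y (scaled_cycle2 i) = (4 * y) ^+ (2 ^ i) * zeval ((4 * y)^-1 - 1) (corb i.+1).
Proof.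
move=> y0; have y1 : 4 * y * ((4 * y)^-1 - 1) = 1 - 4 * y.
  by rewrite mulrBr divff ?mulr1 // mulf_neq0 ?pnatr_eq0.
elim: i => [|i IH]; first by rewrite corb1 !zevalE expr1 y1.
have -> : zeval y (scaled_cycle2 i.+1) =
    zeval y (scaled_cycle2 i) ^+ 2 + (4 * y) ^+ (2 ^ i.+1 - 1) * (1 - 4 * y).
  by rewrite scaled_cycle2S !zevalE.
rewrite zeval_corbS IH [RHS]mulrDr exprMn -exprM -expnSr; congr (_ + _).
have {2}-> : (2 ^ i.+1 = (2 ^ i.+1 - 1) + 1)%N by rewrite subnK // expn_gt0.
by rewrite exprD expr1 -mulrA y1.
Qed.

(** The shape required by [not_Aunit_congruence], with d = 1 and d' = -1. *)
Definition dyadic_congr e (p : {poly int}) :=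
  exists t, p = 1 - 2 ^+ e * 'X + 2 ^+ e.+1 * t.

(** Squaring doubles the deviation from 1, and the square of the deviation is divisible by 2^(2e),
    where 2e >= e + 2. *)
Lemma dyadic_congr_sqr e p : (2 <= e)%N -> dyadic_congr e p ->
  dyadic_congr e.+1 (p ^+ 2).
Proof.
case: e => [|[|e]] // _ [t ->].
exists (t + 2 ^+ e * (2 * t - 'X) ^+ 2); rewrite !exprS; ring.
Qed.

Lemma dyadic_congr_add e k p q : (e < k)%N -> dyadic_congr e p ->
  dyadic_congr e (p + 2 ^+ k * q).
Proof.
move=> ek [t ->]; exists (t + 2 ^+ (k - e.+1) * q).
by rewrite -[in LHS](subnK ek) exprD; ring.
Qed.

Lemma dyadic_scaled_fixed i : dyadic_congr i.+2 (scaled_fixed i.+1).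
Proof.
elim: i => [|i IH].
  by exists 'X^3; rewrite /= (_ : (2 ^ 2 - 2 = 2)%N) // !exprS; ring.
rewrite scaled_fixedS exprMn -[_ * _ * (1 - _)]mulrA -[- (2 ^+ _ * _)]mulrN.
apply: dyadic_congr_add (dyadic_congr_sqr _ IH) => //.
by have := ltn_expl i.+2 (ltnSn 1); rewrite !expnS; lia.
Qed.

Lemma dyadic_scaled_cycle2 i : dyadic_congr i.+2 (scaled_cycle2 i.+1).
Proof.
elim: i => [|i IH]; first by exists 0; rewrite /= (_ : (2 ^ 1 - 1 = 1)%N) // !exprS; ring.
rewrite scaled_cycle2S exprMn -[_ * _ * (1 - _)]mulrA.
have {1}-> : 4 = 2 ^+ 2 :> {poly int} by ring.
rewrite -exprM; apply: dyadic_congr_add (dyadic_congr_sqr _ IH) => //.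
by have := ltn_expl i.+2 (ltnSn 1); rewrite !expnS; lia.
Qed.

(** * Contradictions at the fixed points and at the 2-cycles *)

Lemma prim_root_neq0 n (y : algC) : n.-primitive_root y -> y != 0.
Proof.
move=> py; apply/eqP=> y0; have := prim_expr_order py.
rewrite y0 expr0n gtn_eqF ?(prim_order_gt0 py) // => /eqP.
by rewrite eq_sym oner_eq0.
Qed.

Lemma Aunit_opp_prim_root n (y w : algC) : (0 < n)%N -> n.-primitive_root y ->
  Aunit (w - y^-1) -> Aunit (1 - y * w).
Proof.
move=> n0 py u; have yn := prim_expr_order py.
have y0 := prim_root_neq0 py.
have -> : 1 - y * w = - y * (w - y^-1) by rewrite mulrBr !mulNr divff // opprK addrC.
by apply: AunitM => //; apply/AunitN/(Aunit_unity_root n0).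
Qed.

Lemma prim_rootV n (y : algC) : n.-primitive_root y -> n.-primitive_root y^-1.
Proof.
move=> py; have n0 := prim_order_gt0 py; have yn := prim_expr_order py.
have y0 := prim_root_neq0 py.
have -> : y^-1 = y ^+ n.-1.
  by apply: (mulfI y0); rewrite divff // -exprS prednK.
rewrite prim_root_exp_coprime //.
by case: (n) n0 => // k _; rewrite coprime_sym coprimeSn.
Qed.

Lemma not_Aunit_fixed M n (g1 gn : {poly int}) : (0 < M)%N -> (1 < n)%N ->
    preper M 1 = g1 * 'X ->
    level_part (preper M) n = gn * (if (n %| M)%N then level_part corb n else 1) ->
  ~ (forall c : algC, c \in Aint -> zeval c g1 = 0 -> Aunit (zeval c gn)).
Proof.
case: M => // N _ n1 D1 Dn hu; have n0 := ltnW n1.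
pose q : {poly int} := 'X - 'X^2.
(* The roots of Q are the fixed points x = -a_M(c), with c = x - x^2 and M = N + 1. Its leading
   coefficient is -1 only for N = 0, and P is its monic version. *)
pose Q : {poly int} := (corb N.+1 \Po q) + 'X.
have sq : size q = 3 by rewrite /q addrC size_polyDl size_polyN size_polyXn ?size_polyX.
have lq : lead_coef q = -1.
  by rewrite /q lead_coefDr ?lead_coefN ?lead_coefXn // size_polyN size_polyXn size_polyX.
have scq : size (corb N.+1 \Po q) = (2 ^ N.+1).+1.
  have := size_comp_poly (corb N.+1) q; rewrite size_corb sq /= expnSr.
  by have := expn_gt0 2 N; case: (size _) => [|k] /=; lia.
have ltX : (size ('X : {poly int}) < size (corb N.+1 \Po q))%N.
  by rewrite scq size_polyX !ltnS (leq_trans _ (ltn_expl N.+1 (ltnSn 1))).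
have sQ : size Q = (2 ^ N.+1).+1 by rewrite /Q size_polyDl.
have [b lQ] : exists b : bool, lead_coef Q = (-1) ^+ b.
  exists (odd (2 ^ N)); rewrite /Q lead_coefDl // lead_coef_comp ?sq // lq size_corb.
  by rewrite (monicP (corb_monic _)) // mul1r signr_odd.
pose P := lead_coef Q *: Q.
have mP : P \is monic by rewrite monicE lead_coefZ lQ -expr2 sqrr_sign.
have zP x : zeval x P = (-1) ^+ b * zeval x Q :> algC.
  by rewrite /P -mul_polyC zevalM zevalC lQ rmorph_sign.
have zQ x : zeval x Q = zeval (x - x ^+ 2) (corb N.+1) + x :> algC.
  by rewrite /Q zevalD zeval_comp /q !zevalE.
have QP x : zeval x Q = (-1) ^+ b * zeval x P :> algC.
  by rewrite zP mulrA -expr2 sqrr_sign mul1r.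
have xu (x z : algC) : zeval x P = 0 -> n.-primitive_root z -> Aunit (2 * x - z).
  move=> Px pz; have xA := monic_int_root_Aint mP Px.
  (* The root x = 0 lies over c = 0, the factor X by which u_1 differs from G_(m,1); there 2x - z is
     the unit -z. *)
  have [->|x0] := eqVneq x 0.
    by rewrite mulr0 sub0r; apply/AunitN/(Aunit_unity_root n0)/prim_expr_order.
  move/eqP: Px; rewrite zP mulf_eq0 signr_eq0 /= zQ addr_eq0 => /eqP Ex.
  set c := x - x ^+ 2 in Ex.
  have cA : c \in Aint by rewrite rpredB ?rpredX.
  have c1 : zeval c (preper N.+1 1) = 0.
    by rewrite /preper addn1 zevalD zeval_corbS Ex /c; ring.
  have c0 : c != 0.
    apply/eqP=> c0; have zc i : zeval c (corb i) = 0.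
      by elim: i => [|i IH]; rewrite ?zeval0 // zeval_corbS IH c0 expr0n addr0.
    by move/eqP: Ex; rewrite zc eq_sym oppr_eq0 (negbTE x0).
  apply: (Aunit_Cyclotomic n1 pz); first by rewrite rpredM ?rpred_nat.
  have -> : 2 * x = - (2 * zeval c (corb N.+1)) by rewrite Ex mulrN opprK.
  rewrite -zeval_level_part_fixed // Dn zevalM; apply: AunitM.
    apply: hu => //; move/eqP: c1; rewrite D1 zevalM zevalX mulf_eq0 (negbTE c0) orbF.
    by move/eqP.
  case: ifP => nM; last by exists 1; rewrite ?zeval1 ?mulr1.
  exact: Aunit_level_part_fixed c1.
(* H(y) is (2y)^(deg Q) Q(1/(2y)), which is, up to sign, the product of 1 - 2xy over the roots x of
   Q. *)
pose H := scaled_fixed N + (2 * 'X) ^+ (2 ^ N.+1 - 1).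
have HE (y : algC) : y != 0 -> zeval y H = (2 * y) ^+ (2 ^ N.+1) * zeval ((2 * y)^-1) Q.
  move=> y0; rewrite /H [LHS]zevalD zeval_scaled_fixed // zQ mulrDr; congr (_ + _).
  have {2}-> : (2 ^ N.+1 = (2 ^ N.+1 - 1) + 1)%N by rewrite subnK // expn_gt0.
  by rewrite exprD expr1 -mulrA divff ?mulr1 ?mulf_neq0 ?pnatr_eq0 // !zevalE.
have Hu (y : algC) : n.-primitive_root y -> Aunit (zeval y H).
  move=> py; have y0 := prim_root_neq0 py.
  have sP : size (zroots P) = (2 ^ N.+1)%N.
    apply: succn_inj; rewrite -(size_prod_XsubC _ id) -zrootsE //.
    rewrite size_map_inj_poly //; last exact: intr_inj.
    by rewrite /P size_scale // lQ signr_eq0.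
  have -> : zeval y H = (-1) ^+ b * \prod_(x <- zroots P) (1 - y * (2 * x)).
    rewrite HE // QP mulrCA; congr (_ * _); rewrite /zeval zrootsE // horner_prod -sP.
    elim: (zroots P) => [|x s IH]; first by rewrite !big_nil mulr1.
    rewrite !big_cons -IH exprS mulrACA; congr (_ * _).
    by rewrite hornerXsubC mulrBr divff ?mulf_neq0 ?pnatr_eq0 //; ring.
  apply: AunitM.
    by case: b {lQ zP QP} => /=; [exists (-1)|exists 1];
      rewrite ?rpredN ?mulrNN ?mulr1 ?expr1.
  apply: Aunit_prod => x; rewrite mem_zroots // => /eqP Px.
  by apply: (Aunit_opp_prim_root n0 py); apply: xu => //; exact: prim_rootV.
(* For N = 0, H is -1 + 4X, hence the other choice of signs. *)
case: N @H Hu {D1 Dn hu q Q sq lq scq ltX sQ lQ P mP zP zQ QP xu HE} => [|N] H Hu.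
  apply: (@not_Aunit_congruence n 2 (-1) 1 0 n1) => // y /Hu.
  by congr (Aunit (zeval y _)); rewrite /H /= !rmorphN1 polyC1 expr1 expr2; ring.
have [t Dt] : dyadic_congr N.+2 H.
  rewrite /H exprMn; apply: dyadic_congr_add (dyadic_scaled_fixed N).
  by have := ltn_expl N.+1 (ltnSn 1); rewrite !expnS; lia.
apply: (@not_Aunit_congruence n N.+2 1 (-1) t n1) => // y /Hu.
by congr (Aunit (zeval y _)); rewrite Dt !rmorphN1 polyC1; ring.
Qed.

Lemma not_Aunit_cycle2 M e (g2 gn : {poly int}) : (0 < M)%N -> (1 < e)%N ->
    level_part (preper M) 2 = g2 * (if (2 %| M)%N then level_part corb 2 else 1) ->
    level_part (preper M) (2 * e) =
      gn * (if (2 * e %| M)%N then level_part corb (2 * e) else 1) ->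
  ~ (forall c : algC, c \in Aint -> zeval c g2 = 0 -> Aunit (zeval c gn)).
Proof.
case: M => // N _ e1 D2 Dn hu; have e0 := ltnW e1.
pose P : {poly int} := corb N.+2 - corb N.+1 + 1.
have DP : level_part (preper N.+1) 2 = P by rewrite level_part2.
pose r : {poly int} := 1 - corb N.+1.
have ltC : (size r < size (corb N.+2))%N.
  rewrite size_corb ltnS (leq_trans (size_polyD _ _)) // size_polyN size_corb.
  by rewrite size_poly1 geq_max expn_gt0 /= ltn_exp2l.
have PE : P = corb N.+2 + r by rewrite /P /r; ring.
have sP : size P = (2 ^ N.+1).+1 by rewrite PE size_polyDl // size_corb.
have mP : P \is monic by rewrite PE monicE lead_coefDl //; exact: corb_monic.
have zPE (c : algC) : zeval c P = zeval c (corb N.+2) - zeval c (corb N.+1) + 1.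
  by rewrite /P [LHS]zevalD [X in X + _ = _]zevalD zevalN zeval1.
have cu (c z : algC) : zeval c P = 0 -> e.-primitive_root z -> Aunit (4 * (c + 1) - z).
  move=> Pc pz; have cA := monic_int_root_Aint mP Pc.
  (* At c = -1, the only root of V_2, the number 4(c + 1) - z is the unit -z; elsewhere W_2(c) = 0
     forces g2(c) = 0. *)
  have [->|c0] := eqVneq (c + 1) 0.
    by rewrite mulr0 sub0r; apply/AunitN/(Aunit_unity_root e0)/prim_expr_order.
  have c2 : zeval c (level_part (preper N.+1) 2) = 0 by rewrite DP.
  apply: (Aunit_Cyclotomic e1 pz); first by rewrite rpredM ?rpred_nat ?rpredD.
  rewrite -(zeval_level_part_cycle2 _ e1 c2) // Dn zevalM; apply: AunitM.
    apply: hu => //; move: c2; rewrite D2; case: ifP => _; last by rewrite mulr1.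
    rewrite level_part_corb2 zevalM zevalD zevalX zeval1 => /eqP.
    by rewrite mulf_eq0 (negbTE c0) orbF => /eqP.
  case: ifP => nM; last by exists 1; rewrite ?zeval1 ?mulr1.
  by apply: Aunit_level_part_cycle2 c2; rewrite ?dvdn_mulr //; lia.
(* The three terms of P at c = 1/(4y) - 1, multiplied by (4y)^(deg P). *)
pose H := scaled_cycle2 N.+1 - (4 * 'X) ^+ (2 ^ N) * scaled_cycle2 N
  + (4 * 'X) ^+ (2 ^ N.+1).
have HE (y : algC) : y != 0 ->
    zeval y H = (4 * y) ^+ (2 ^ N.+1) * zeval ((4 * y)^-1 - 1) P.
  move=> y0; rewrite /H [LHS]zevalD [X in X + _ = _]zevalD zevalN zevalM !zeval_exp.
  rewrite zevalM zevalX (_ : zeval y 4 = 4) ?(rmorph_nat (zeval y)) //.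
  rewrite !zeval_scaled_cycle2 // zPE.
  have -> : (2 ^ N.+1 = 2 ^ N + 2 ^ N)%N by rewrite expnS mul2n addnn.
  by rewrite exprD; ring.
have Hu (y : algC) : e.-primitive_root y -> Aunit (zeval y H).
  move=> py; have y0 := prim_root_neq0 py.
  have szP : size (zroots P) = (2 ^ N.+1)%N.
    apply: succn_inj; rewrite -(size_prod_XsubC _ id) -zrootsE //.
    by rewrite size_map_inj_poly //; exact: intr_inj.
  have -> : zeval y H = \prod_(c <- zroots P) (1 - y * (4 * (c + 1))).
    rewrite HE // /zeval zrootsE // horner_prod -szP.
    elim: (zroots P) => [|x s IH]; first by rewrite !big_nil mulr1.
    rewrite !big_cons -IH exprS mulrACA; congr (_ * _).
    by rewrite hornerXsubC !mulrBr divff ?mulf_neq0 ?pnatr_eq0 //; ring.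
  apply: Aunit_prod => c; rewrite mem_zroots // => /eqP Pc.
  by apply: (Aunit_opp_prim_root e0 py); apply: cu => //; exact: prim_rootV.
have [k [t k2 Dt]] : exists k, exists2 t, (2 <= k)%N & H = 1 - 2 ^+ k * 'X + 2 ^+ k.+1 * t.
  case: N @H {D2 Dn hu P r DP ltC PE sP mP zPE cu HE Hu} => [|N] H.
    (* For N = 0 the middle term still affects the linear coefficient, and H = 1 - 8X + 32X^2; for
       larger N the last two terms are negligible modulo the required power of 2. *)
    exists 3%N; exists (2 * 'X^2) => //.
    rewrite /H scaled_cycle2S /= (_ : (2 ^ 1 - 1 = 1)%N) // (_ : (2 ^ 0 = 1)%N) //.
    by rewrite (_ : (2 ^ 1 = 2)%N) // !exprS; ring.
  have E4 k : (4 * 'X) ^+ k = 2 ^+ (2 * k) * 'X^k :> {poly int}.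
    by rewrite exprMn exprM; congr (_ ^+ _ * _); ring.
  have lt : (N.+3 < 2 * 2 ^ N.+1)%N.
    by have := ltn_expl N.+1 (ltnSn 1); rewrite !expnS; lia.
  have lt' : (N.+3 < 2 * 2 ^ N.+2)%N by rewrite expnS; lia.
  have [t Dt] : dyadic_congr N.+3 H.
    rewrite /H !E4 -[- (_ * _ * _)]mulNr -[- (_ * _)]mulrN -[2 ^+ _ * - _ * _]mulrA.
    exact: dyadic_congr_add lt' (dyadic_congr_add _ lt (dyadic_scaled_cycle2 N.+1)).
  by exists N.+3; exists t.
apply: (@not_Aunit_congruence e k 1 (-1) t e1) => // y /Hu.
by congr (Aunit (zeval y _)); rewrite Dt !rmorphN1 polyC1; ring.
Qed.

(** * Transfer from the number field and conclusion *)

Lemma zeval_in_alg (L : fieldExtType rat) (c0 : L) p :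
  zeval c0 p = (map_poly (in_alg L) (map_poly intr p)).[c0].
Proof.
rewrite /zeval -map_poly_comp; congr (_.[_]).
by apply: eq_map_poly => a; rewrite /= -in_algE rmorph_int.
Qed.

(* The inverse of an integral unit [b] lies in Z[b], so invertibility is
   witnessed by an identity between integer polynomials. *)
Lemma unit_transfer (g h : {poly int}) (L : fieldExtType rat) (c0 : L) :
    h \is monic -> irreducible_poly (map_poly (intr : int -> rat) h) ->
    zeval c0 h = 0 ->
    (exists2 y, integralOver (intr : int -> L) y & zeval c0 g * y = 1) ->
  forall c : algC, c \in Aint -> zeval c g = 0 -> Aunit (zeval c h).
Proof.
move=> mh irr hc0 [y [q mq qy] gy] c cA gc.
have [k Dk] : exists k : {poly int}, zeval c0 g * zeval c0 k = 1.
  suff [k Dk] : exists k : {poly int}, y = zeval c0 k by exists k; rewrite -Dk.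
  set b := zeval c0 g in gy; pose d := (size q).-1.
  (* Multiplying the monic equation of y, of degree d, by b^(d-1) and using by = 1 expresses y as a
     polynomial in b. *)
  exists (- \sum_(i < d) (q`_i)%:P * g ^+ (d.-1 - i)).
  have sq : size q = d.+1.
    by rewrite /d prednK // size_poly_gt0 monic_neq0.
  move/rootP: qy; rewrite horner_coef size_map_poly_id0; last first.
    by rewrite (monicP mq) oner_eq0.
  rewrite sq big_ord_recr /= !coef_map /=.
  have -> : q`_d = 1 by rewrite -(monicP mq) lead_coefE sq.
  rewrite mul1r; case: d sq => [|d] sq.
    by rewrite big_ord0 add0r expr0 => /eqP; rewrite oner_eq0.
  move/(congr1 (fun x => x * b ^+ d)); rewrite mul0r mulrDl.
  rewrite exprS -mulrA -exprMn (mulrC y b) gy expr1n mulr1 => /eqP.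
  rewrite addrC addr_eq0 => /eqP->; rewrite zevalN raddf_sum /=; congr (- _).
  rewrite mulr_suml; apply: eq_bigr => i _.
  rewrite zevalM zevalC zeval_exp -/b coef_map /= -mulrA; congr (_ * _).
  have id : (i <= d)%N by rewrite -ltnS.
  by rewrite -[X in _ * b ^+ X = _](subnKC id) exprD mulrA -exprMn (mulrC y) gy expr1n mul1r.
(* T vanishes at c0, so the irreducible h divides it over Q and, being monic, over Z. At a root of g
   this reads -1 = s(c) h(c). *)
pose T := g * k - 1.
have Tc0 : zeval c0 T = 0 by rewrite /T zevalD zevalM zevalN zeval1 Dk subrr.
have dvdT : map_poly (intr : int -> rat) h %| map_poly intr T.
  have [|nz] := boolP (coprimep (map_poly (intr : int -> rat) h) (map_poly intr T)).
    case/Bezout_eq1_coprimepP=> -[u v] /= /(congr1 (fun p => (map_poly (in_alg L) p).[c0])).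
    rewrite rmorphD !rmorphM rmorph1 /= hornerD !hornerM -!zeval_in_alg hc0 Tc0 !mulr0 addr0 hornerC.
    by move/eqP; rewrite eq_sym oner_eq0.
  have := irr.2 _ _ (dvdp_gcdl (map_poly intr h) (map_poly intr T)).
  by move=> /(_ nz) /eqp_dvdl <-; exact: dvdp_gcdr.
have [r Dr] := dvdpP _ _ dvdT.
have [s Ds _] := monic_int_quotient (@intr_inj rat) mh Dr.
exists (- zeval c s); first by rewrite rpredN zeval_Aint.
have := congr1 (zeval c) Ds; rewrite /T zevalD zevalM zevalN zeval1 gc mul0r zevalM.
by rewrite sub0r mulrN mulrC => <-; rewrite opprK.
Qed.

Lemma zeval_ring_of_integers (g h : {poly int}) (L : fieldExtType rat) (c0 : L) :
    h \is monic -> zeval c0 h = 0 ->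
  ring_of_integers <<1; c0>>%VS (zeval c0 g).
Proof.
move=> mh hc; split.
  apply: mempx_Fadjoin; apply/polyOverP=> i; rewrite coef_map /=.
  by rewrite rpred_int.
apply: integral_horner; last by exists h => //; exact/rootP.
by apply/integral_poly=> i; rewrite coef_map; exact: integral_id.
Qed.

Lemma misiurewicz_factor_monic m n g : (2 <= m)%N -> (0 < n)%N ->
    level_part (preper m.-1) n = g * (if (n %| m.-1)%N then level_part corb n else 1) ->
  g \is monic.
Proof.
move=> m2 n0 Eg; have M0 : (0 < m.-1)%N by rewrite -subn1 subn_gt0.
have := level_part_monic (preper_level_sequence M0) n0; rewrite Eg.
case: ifP => _; last by rewrite mulr1.
by rewrite monicMr // level_part_monic //; exact: corb_level_sequence.
Qed.

Theorem theorem1p7 (m n : nat) (hm : (2 <= m)%N) (hn : (2 <= n)%N)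
    (hirr : irreducible_poly (misiurewicz m n))
    (L : fieldExtType rat) (c0 : L)
    (hc0 : root (map_poly (in_alg L) (misiurewicz m n)) c0) :
  is_nonunit (ring_of_integers <<1; c0>>%VS)
             (map_poly (in_alg L) (misiurewicz m 1)).[c0] /\
  (~~ odd n ->
   is_nonunit (ring_of_integers <<1; c0>>%VS)
              (map_poly (in_alg L) (misiurewicz m 2)).[c0]).
Proof.
have M0 : (0 < m.-1)%N by rewrite -subn1 subn_gt0.
have [gn Dn En] := misiurewicz_level_part hm (ltnW hn).
have [g1 D1 E1] := misiurewicz_level_part hm (ltn0Sn 0).
have [g2 D2 E2] := misiurewicz_level_part hm (ltn0Sn 1).
have mn := misiurewicz_factor_monic hm (ltnW hn) En.
rewrite Dn in hirr; move: hc0; rewrite Dn D1 D2 /root -!zeval_in_alg => /eqP hc0.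
split=> [|en]; (split; first exact: zeval_ring_of_integers hc0) => -[y [_ yI] gy].
  apply: (@not_Aunit_fixed m.-1 n g1 gn) => //.
    (* Since 1 divides m - 1, the correction for G_(m,1) is always present and equals 1/X. *)
    by move: E1; rewrite dvd1n !level_part1 ?corb1 //;
       [exact: corb_level_sequence | exact: preper_level_sequence].
  by apply: (unit_transfer mn hirr hc0); exists y.
(* For n = 2 the value G_(m,2)(c0) is 0. *)
have [n2|n2] := eqVneq n 2%N.
  have E : gn = g2 by apply: (map_inj_poly (@intr_inj rat)) => //; rewrite -Dn -D2 n2.
  by move/eqP: gy; rewrite -E hc0 mul0r eq_sym oner_eq0.
have nE : n = (2 * n./2)%N by rewrite mul2n even_halfK.
have e1 : (1 < n./2)%N by lia.
rewrite nE in En; apply: (not_Aunit_cycle2 M0 e1 E2 En).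
by apply: (unit_transfer mn hirr hc0); exists y.
Qed.
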